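(* Let $\mathbb{k}$ be a commutative ring and let $\mathcal{G}$ be a finite groupoid. Then the rings $Z(\mathbb{k}[\mathcal{G}])$ and $Z(Y_{\mathbb{k}}(\mathcal{G}))$ are isomorphic, where $\mathbb{k}[\mathcal{G}]$ is the groupoid algebra and $Y_{\mathbb{k}}(\mathcal{G})$ is the Yoshida algebra of $\mathcal{G}$.
   Context: A groupoid is a (small) category in which every morphism is invertible; $\mathcal{G}_0$, $\mathcal{G}_1$ denote its sets of objects and of morphisms, both finite here. For $x\in\mathcal{G}_0$, $\mathcal{G}_x:=\mathcal{G}(x,x)$ is the isotropy group at $x$. $Z(A)$ denotes the center of a ring $A$. Groupoid algebra: $\mathbb{k}[\mathcal{G}]$ is the free $\mathbb{k}$-module with basis $\mathcal{G}_1$ and multiplication $(\sum_g x_g g)*(\sum_h y_h h)=\sum x_g y_h\, gh$, the last sum running over pairs $(g,h)\in\mathcal{G}_1\times\mathcal{G}_1$ with domain of $g$ equal to codomain of $h$. $\mathcal{G}$-sets and representations: A $\mathcal{G}$-set is a functor from $\mathcal{G}$ to finite sets; products of $\mathcal{G}$-sets are objectwise. $\mathbb{k}\text{-}\mathbf{mod}$ is the category of finitely generated $\mathbb{k}$-modules and $\mathbb{k}\text{-}\mathbf{mod}^{\mathcal{G}}$ is the category of functors $\mathcal{G}\to\mathbb{k}\text{-}\mathbf{mod}$ and natural transformations. For a $\mathcal{G}$-set $X$, $\mathbb{k}[X]:\mathcal{G}\to\mathbb{k}\text{-}\mathbf{mod}$ sends $x$ to the free module $\mathbb{k}[X(x)]$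 on $X(x)$ and a morphism $g$ to the $\mathbb{k}$-linear extension of $X(g)$. The endomorphism set $\mathbb{k}\text{-}\mathbf{mod}^{\mathcal{G}}(\mathbb{k}[X],\mathbb{k}[X])$ is a ring under objectwise addition and composition. The $\mathcal{G}$-set $\Omega$: Let $\mathcal{G}\cong\coprod_{i=1}^n\mathcal{G}[i]$ be the decomposition into connected components. For a finite set $X$, $\mathrm{Pair}(X)$ is the groupoid with object set $X$ and exactly one morphism $(x,y):x\to y$ for each $(x,y)\in X\times X$. For each $i$ fix a base object $x_i\in\mathcal{G}[i]_0$ and an identification (identity on objects) $\mathcal{G}[i]\cong\mathcal{G}_{x_i}\times\mathrm{Pair}(\mathcal{G}[i]_0)$, and write $\lambda_{x,y}\in\mathcal{G}(x,y)$ for the morphism corresponding to $(x,y)$ (with identity group component); thus $\lambda_{x,x}=\mathrm{id}_x$ and $\lambda_{y,z}\lambda_{x,y}=\lambda_{x,z}$. The functor $\Omega$ from $\mathcal{G}$ to finite sets is given by $\Omega(x):=\coprod_{H\le\mathcal{G}_x}\mathcal{G}_x/H$ (disjoint union over all subgroups $H$, elements written $\langle H,kH\rangle$), and for $g:x\to y$, $\Omega(g)\langle H,kH\rangle:=\langle\lambda_{x,y}H\lambda_{x,y}^{-1},\,gkH\lambda_{x,y}^{-1}\rangle$. Yoshida algebra: $Y_{\mathbb{k}}(\mathcal{G}):=\mathbb{k}\text{-}\mathbf{mod}^{\mathcal{G}}(\mathbb{k}[\Omega^2],\mathbb{k}[\Omega^2])$, where $\Omega^2=\Omega\times\Omega$.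 *)

(* Defs.v *)
(* Commutative rings are [comPzRingType] (the zero ring is allowed), and all
   algebras below are [pzRingType]: over the empty groupoid they are zero. *)
From HB Require Import structures.
From mathcomp Require Import all_boot all_order all_fingroup all_algebra.
From mathcomp Require Import boolp.

Set Implicit Arguments.
Unset Strict Implicit.
Unset Printing Implicit Defensive.

Import GRing.Theory.
Local Open Scope ring_scope.

Section Center.
Variable R : pzRingType.

Definition in_center : {pred R} := fun x => `[< forall y : R, x * y = y * x >].

Lemma in_centerP x : reflect (forall y : R, x * y = y * x) (x \in in_center).
Proof. exact: asboolP. Qed.

Lemma in_center_subring : subring_closed in_center.
Proof.
split=> [|x y /in_centerP cx /in_centerP cy|x y /in_centerP cx /in_centerP cy];
  apply/in_centerP => z.
- by rewrite mul1r mulr1.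
- by rewrite mulrBl mulrBr cx cy.
- by rewrite -mulrA cy mulrA cx mulrA.
Qed.

HB.instance Definition _ := GRing.isSubringClosed.Build R in_center
  in_center_subring.

Record center := Center { center_val :> R; _ : center_val \in in_center }.

HB.instance Definition _ := [isSub for center_val].
HB.instance Definition _ := [Choice of center by <:].
HB.instance Definition _ := GRing.SubChoice_isSubPzRing.Build R in_center center
  in_center_subring.
End Center.

(* Finite groupoids.  [gcomp g f] is "g after f". *)
Record groupoid := Groupoid {
  gobj :> finType;
  hom : gobj -> gobj -> finType;
  gid : forall x, hom x x;
  gcomp : forall x y z, hom y z -> hom x y -> hom x z;
  ginv : forall x y, hom x y -> hom y x;
  gcompA : forall x y z w (h : hom z w) (g : hom y z) (f : hom x y),
    gcomp h (gcomp g f) = gcomp (gcomp h g) f;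
  gcomp1f : forall x y (f : hom x y), gcomp (gid y) f = f;
  gcompf1 : forall x y (f : hom x y), gcomp f (gid x) = f;
  gcompVf : forall x y (f : hom x y), gcomp (ginv f) f = gid x;
  gcompfV : forall x y (f : hom x y), gcomp f (ginv f) = gid y
}.

Arguments hom {g} x y : rename.
Arguments gid {g} x : rename.
Arguments gcomp {g x y z} _ _ : rename.
Arguments ginv {g x y} _ : rename.

Declare Scope groupoid_scope.
Delimit Scope groupoid_scope with gpd.
Notation "g \c f" := (gcomp g f) (at level 40, left associativity)
  : groupoid_scope.
Local Open Scope groupoid_scope.

Definition isotropy (G : groupoid) (x : G) : Type := hom x x.

Section Isotropy.
Variables (G : groupoid) (x : G).

HB.instance Definition _ := Finite.on (isotropy x).
HB.instance Definition _ := Finite_isGroup.Build (isotropy x)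
  (@gcompA G x x x x) (@gcomp1f G x x) (@gcompVf G x x).
End Isotropy.

Definition pair_groupoid (X : finType) : groupoid.
Proof.
refine (@Groupoid X (fun _ _ => unit : finType) (fun=> tt)
  (fun _ _ _ _ _ => tt) (fun _ _ _ => tt) _ _ _ _ _) => //;
  by move=> x y [].
Defined.

(* The product of a finite group, seen as a one-object groupoid, with a
   groupoid; its objects are those of the latter. *)
Definition group_prod_groupoid (gT : finGroupType) (G : groupoid) : groupoid.
Proof.
refine (@Groupoid G (fun x y => (gT * hom x y)%type : finType)
  (fun x => (1%g, gid x)) (fun x y z g f => ((g.1 * f.1)%g, g.2 \c f.2))
  (fun x y f => ((f.1)^-1%g, ginv f.2)) _ _ _ _ _).
- by move=> x y z w h g f; rewrite /= mulgA gcompA.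
- by move=> x y [a f]; rewrite /= mul1g gcomp1f.
- by move=> x y [a f]; rewrite /= mulg1 gcompf1.
- by move=> x y [a f]; rewrite /= mulVg gcompVf.
- by move=> x y [a f]; rewrite /= mulgV gcompfV.
Defined.

Definition full_subgroupoid (G : groupoid) (A : {set G}) : groupoid.
Proof.
refine (@Groupoid {x : G | x \in A}
  (fun x y => @hom G (val x) (val y)) (fun x => gid (val x))
  (fun x y z g f => g \c f) (fun x y f => ginv f) _ _ _ _ _).
- by move=> *; apply: gcompA.
- by move=> *; apply: gcomp1f.
- by move=> *; apply: gcompf1.
- by move=> *; apply: gcompVf.
- by move=> *; apply: gcompfV.
Defined.

Section Components.
Variable G : groupoid.

Definition gconn : rel G := fun x y => (0 < #|hom x y|)%N.

Lemma gconnP x y : reflect (inhabited (hom x y)) (gconn x y).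
Proof.
by apply: (iffP card_gt0P) => [[f _]|[f]]; [exact: inhabits f|exists f].
Qed.

Lemma gconn_hom x y : hom x y -> gconn x y.
Proof. by move=> f; apply/gconnP. Qed.

Lemma gconnxx x : gconn x x. Proof. exact: gconn_hom (gid x). Qed.

Lemma gconn_sym x y : gconn x y -> gconn y x.
Proof. by case/gconnP => f; apply: gconn_hom (ginv f). Qed.

Lemma gconn_trans x y z : gconn x y -> gconn y z -> gconn x z.
Proof. by move=> /gconnP[f] /gconnP[g]; apply: gconn_hom (g \c f). Qed.

Definition component :=
  {C : {set G} | C \in equivalence_partition gconn [set: G]}.

Definition component_obj (C : component) : finType := {x : G | x \in val C}.

Lemma component_of_subproof x :
  [set y in [set: G] | gconn x y] \in equivalence_partition gconn [set: G].
Proof. exact: imset_f. Qed.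

Definition component_of (x : G) : component :=
  exist _ [set y in [set: G] | gconn x y] (component_of_subproof x).

Lemma in_component_of x y : (y \in val (component_of x)) = gconn x y.
Proof. by rewrite !inE. Qed.

Lemma component_ofP (C : component) x : x \in val C -> C = component_of x.
Proof.
move=> xC; apply: val_inj => /=.
case: C xC => C /= /imsetP[z _ ->]; rewrite !inE => zx.
apply/setP => y; rewrite !inE; apply/idP/idP; last exact: gconn_trans.
exact/gconn_trans/gconn_sym.
Qed.
End Components.

Definition component_groupoid (G : groupoid) (C : component G) : groupoid :=
  full_subgroupoid (val C).

Definition split_groupoid (G : groupoid) (C : component G)
  (b : component_obj C) : groupoid :=
  group_prod_groupoid (isotropy (val b)) (pair_groupoid (component_obj C)).

(* A choice, for every connected component [C], of a base object [b] in [C]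
   and of an isomorphism of groupoids, the identity on objects, from
   [G_b x Pair(C)] to the full subgroupoid on [C]. *)
Record trivialization (G : groupoid) := Trivialization {
  tbase : forall C : component G, component_obj C;
  tmap : forall (C : component G) (x y : component_obj C),
    @hom (split_groupoid (tbase C)) x y -> @hom (component_groupoid C) x y;
  tmap_id : forall (C : component G) (x : component_obj C),
    tmap (@gid (split_groupoid (tbase C)) x) = @gid (component_groupoid C) x;
  tmap_comp : forall (C : component G) (x y z : component_obj C)
    (g : @hom (split_groupoid (tbase C)) y z)
    (f : @hom (split_groupoid (tbase C)) x y),
    tmap (@gcomp (split_groupoid (tbase C)) x y z g f) =
    @gcomp (component_groupoid C) x y z (tmap g) (tmap f);
  tmap_bij : forall (C : component G) (x y : component_obj C),
    bijective (@tmap C x y)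
}.

Section Lambda.
Variables (G : groupoid) (t : trivialization G).

Lemma lambda_src (x : G) : x \in val (component_of x).
Proof. by rewrite in_component_of gconnxx. Qed.

Lemma lambda_tgt (x y : G) : gconn x y -> y \in val (component_of x).
Proof. by rewrite in_component_of. Qed.

Definition lambda (x y : G) (c : gconn x y) : hom x y :=
  @tmap G t (component_of x)
    (exist _ x (lambda_src x)) (exist _ y (lambda_tgt c)) (1%g, tt).

Lemma lambdaE (C : component G) (x y : G) (xC : x \in val C) (yC : y \in val C)
    (c : gconn x y) :
  lambda c = @tmap G t C (exist _ x xC) (exist _ y yC) (1%g, tt).
Proof.
have eC := component_ofP xC; subst C; rewrite /lambda.
by rewrite (bool_irrelevance (lambda_src x) xC)
           (bool_irrelevance (lambda_tgt c) yC).
Qed.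

Lemma lambda_id (x : G) (c : gconn x x) : lambda c = gid x.
Proof.
rewrite (lambdaE (lambda_src x) (lambda_src x)).
exact: (@tmap_id G t (component_of x) (exist _ x (lambda_src x))).
Qed.

Lemma lambda_comp (x y z : G) (c : gconn x y) (d : gconn y z) (e : gconn x z) :
  lambda d \c lambda c = lambda e.
Proof.
rewrite (lambdaE (lambda_src x) (lambda_tgt c) c).
rewrite (lambdaE (lambda_tgt c) (lambda_tgt e) d).
rewrite (lambdaE (lambda_src x) (lambda_tgt e) e).
rewrite -[LHS](@tmap_comp G t (component_of x) (exist _ x (lambda_src x))
  (exist _ y (lambda_tgt c)) (exist _ z (lambda_tgt e)) (1%g, tt) (1%g, tt)).
by rewrite /= mulg1.
Qed.
End Lambda.

Record gset (G : groupoid) := GSet {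
  gset_car :> G -> finType;
  gset_act : forall x y, hom x y -> gset_car x -> gset_car y;
  gset_act_id : forall x p, gset_act (gid x) p = p;
  gset_act_comp : forall x y z (g : hom y z) (f : hom x y) p,
    gset_act (g \c f) p = gset_act g (gset_act f p)
}.

Arguments gset_act {G} g {x y} _ _ : rename.

Definition gset_prod (G : groupoid) (X Y : gset G) : gset G.
Proof.
refine (@GSet G (fun x => (X x * Y x)%type : finType)
  (fun x y g p => (gset_act X g p.1, gset_act Y g p.2)) _ _).
- by move=> x [p q]; rewrite /= !gset_act_id.
- by move=> x y z g f [p q]; rewrite /= !gset_act_comp.
Defined.

Section Omega.
Variables (G : groupoid) (t : trivialization G).

(* The pair [(H, C)] with [C] a left coset of [H] encodes <H, kH>, C = kH. *)
Definition omega_car (x : G) : finType :=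
  {p : {group isotropy x} * {set isotropy x}
     | p.2 \in lcosets p.1 [set: isotropy x]}.

Definition conj_set (x y : G) (l : hom x y) (H : {set isotropy x}) :
  {set isotropy y} := [set (l \c h \c ginv l : isotropy y) | h : isotropy x in H].

Lemma ginvK (x y z : G) (l : hom x y) (f : hom x z) :
  f \c ginv l \c l = f.
Proof. by rewrite -gcompA gcompVf gcompf1. Qed.

Lemma conj_group_set (x y : G) (l : hom x y) (H : {group isotropy x}) :
  group_set (conj_set l H).
Proof.
apply/group_setP; split=> [|_ _ /imsetP[a aH ->] /imsetP[b bH ->]].
  by apply/imsetP; exists 1%g => //; rewrite (gcompf1 l) gcompfV.
apply/imsetP; exists (a * b)%g; first exact: groupM.
by rewrite /mulg /= !gcompA ginvK.
Qed.

Definition conj_group (x y : G) (l : hom x y) (H : {group isotropy x}) :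
  {group isotropy y} := group (conj_group_set l H).

Definition move_set (x y : G) (g l : hom x y) (C : {set isotropy x}) :
  {set isotropy y} := [set (g \c c \c ginv l : isotropy y) | c : isotropy x in C].

Lemma move_set_lcoset (x y : G) (g l : hom x y) (H : {group isotropy x}) C :
  C \in lcosets H [set: isotropy x] ->
  move_set g l C \in lcosets (conj_group l H) [set: isotropy y].
Proof.
case/lcosetsP => k _ ->{C}; apply/lcosetsP.
exists (g \c (k : hom x x) \c ginv l) => //; apply/setP => m.
apply/imsetP/lcosetP => [[_ /lcosetP[h hH ->] ->]|[_ /imsetP[h hH ->] ->]].
  exists (l \c (h : hom x x) \c ginv l); first exact: imset_f.
  by rewrite /mulg /= !gcompA ginvK.
exists (k * h)%g; first by apply/lcosetP; exists h.
by rewrite /mulg /= !gcompA ginvK.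
Qed.

(* <H, kH> |-> <l H l^-1, g k H l^-1>, where l = lambda_{x,y}. *)
Definition omega_act (x y : G) (g : hom x y) (p : omega_car x) : omega_car y :=
  let l := lambda t (gconn_hom g) in
  exist _ (conj_group l (val p).1, move_set g l (val p).2)
    (move_set_lcoset g l (valP p)).

Lemma ginv_id (x : G) : ginv (gid x) = gid x.
Proof. by rewrite -[LHS]gcompf1 gcompVf. Qed.

Lemma ginv_comp (x y z : G) (g : hom y z) (f : hom x y) :
  ginv (g \c f) = ginv f \c ginv g.
Proof.
rewrite -[LHS]gcompf1 -[gid z](gcompfV g) -{2}[g](gcompf1 g) -(gcompfV f).
by rewrite !gcompA -[_ \c g \c f]gcompA gcompVf gcomp1f.
Qed.

Lemma move_set_id (x : G) (C : {set isotropy x}) :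
  move_set (gid x) (gid x) C = C.
Proof.
rewrite /move_set ginv_id -[RHS]imset_id.
by apply: eq_imset => c; rewrite gcompf1 gcomp1f.
Qed.

Lemma move_set_comp (x y z : G) (g k : hom y z) (f l : hom x y) C :
  move_set (g \c f) (k \c l) C = move_set g k (move_set f l C).
Proof.
rewrite /move_set -imset_comp; apply: eq_imset => c /=.
by rewrite ginv_comp !gcompA.
Qed.

Lemma omega_act_id x (p : omega_car x) : omega_act (gid x) p = p.
Proof.
apply: val_inj; case: p => [[H C] HC] /=; congr pair.
  by apply: val_inj; rewrite /= lambda_id; apply: move_set_id.
by rewrite lambda_id move_set_id.
Qed.

Lemma omega_act_comp x y z (g : hom y z) (f : hom x y) (p : omega_car x) :
  omega_act (g \c f) p = omega_act g (omega_act f p).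
Proof.
have e := lambda_comp t (gconn_hom f) (gconn_hom g) (gconn_hom (g \c f)).
apply: val_inj; case: p => [[H C] HC] /=; congr pair.
  by apply: val_inj; rewrite /= -e; apply: move_set_comp.
by rewrite -e; apply: move_set_comp.
Qed.

Definition omega : gset G := GSet omega_act_id omega_act_comp.
End Omega.

Definition finitely_generated (k : pzRingType) (V : lmodType k) : Prop :=
  exists (n : nat) (e : 'I_n -> V),
    forall v, exists c : 'I_n -> k, v = \sum_(i < n) c i *: e i.

(* Functors from G to finitely generated k-modules. *)
Record rep (k : comPzRingType) (G : groupoid) := Rep {
  rep_car :> G -> lmodType k;
  rep_fg : forall x, finitely_generated (rep_car x);
  rep_act : forall x y, hom x y -> rep_car x -> rep_car y;
  rep_act_linear : forall x y (g : hom x y), linear (rep_act g);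
  rep_act_id : forall x v, rep_act (gid x) v = v;
  rep_act_comp : forall x y z (g : hom y z) (f : hom x y) v,
    rep_act (g \c f) v = rep_act g (rep_act f v)
}.

Arguments rep_act {k G} r {x y} _ _ : rename.

Record rep_hom (k : comPzRingType) (G : groupoid) (M N : rep k G) := RepHom {
  rep_hom_fun :> forall x, M x -> N x;
  rep_hom_linear : forall x, linear (rep_hom_fun (x:=x));
  rep_hom_natural : forall x y (g : hom x y) (v : M x),
    rep_hom_fun (rep_act M g v) = rep_act N g (rep_hom_fun v)
}.

Section RepHom.
Variables (k : comPzRingType) (G : groupoid) (M N : rep k G).

HB.instance Definition _ := gen_eqMixin (rep_hom M N).
HB.instance Definition _ := gen_choiceMixin (rep_hom M N).

Lemma rep_homP (a b : rep_hom M N) : (forall x v, a x v = b x v) -> a = b.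
Proof.
case: a b => [a la na] [b lb nb] /= ab.
have e : a = b.
  apply: functional_extensionality_dep => x.
  exact: functional_extensionality_dep.
by subst b; congr RepHom; apply: Prop_irrelevance.
Qed.

Lemma rep_actD x y (g : hom x y) (v w : N x) :
  rep_act N g (v + w) = rep_act N g v + rep_act N g w.
Proof. by have := rep_act_linear g 1 v w; rewrite !scale1r. Qed.

Lemma rep_act0 x y (g : hom x y) : rep_act N g 0 = 0.
Proof. by apply: (addIr (rep_act N g 0)); rewrite -rep_actD !add0r. Qed.

Lemma rep_actN x y (g : hom x y) (v : N x) :
  rep_act N g (- v) = - rep_act N g v.
Proof.
by apply: (addIr (rep_act N g v)); rewrite -rep_actD !addNr rep_act0.
Qed.

Definition rep_hom_zero : rep_hom M N.
Proof.
refine (@RepHom _ _ M N (fun x _ => 0) _ _).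
- by move=> x a u v; rewrite scaler0 addr0.
- by move=> x y g v; rewrite rep_act0.
Defined.

Definition rep_hom_opp (a : rep_hom M N) : rep_hom M N.
Proof.
refine (@RepHom _ _ M N (fun x v => - a x v) _ _).
- by move=> x c u v; rewrite rep_hom_linear opprD scalerN.
- by move=> x y g v; rewrite rep_hom_natural rep_actN.
Defined.

Definition rep_hom_add (a b : rep_hom M N) : rep_hom M N.
Proof.
refine (@RepHom _ _ M N (fun x v => a x v + b x v) _ _).
- by move=> x c u v; rewrite !rep_hom_linear scalerDr addrACA.
- by move=> x y g v; rewrite !rep_hom_natural rep_actD.
Defined.

Lemma rep_hom_addA : associative rep_hom_add.
Proof. by move=> a b c; apply: rep_homP => x v; apply: addrA. Qed.

Lemma rep_hom_addC : commutative rep_hom_add.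
Proof. by move=> a b; apply: rep_homP => x v; apply: addrC. Qed.

Lemma rep_hom_add0 : left_id rep_hom_zero rep_hom_add.
Proof. by move=> a; apply: rep_homP => x v; apply: add0r. Qed.

Lemma rep_hom_addN : left_inverse rep_hom_zero rep_hom_opp rep_hom_add.
Proof. by move=> a; apply: rep_homP => x v; apply: addNr. Qed.

HB.instance Definition _ := GRing.isZmodule.Build (rep_hom M N)
  rep_hom_addA rep_hom_addC rep_hom_add0 rep_hom_addN.
End RepHom.

Definition rep_end (k : comPzRingType) (G : groupoid) (M : rep k G) : Type :=
  rep_hom M M.

Section RepEnd.
Variables (k : comPzRingType) (G : groupoid) (M : rep k G).

HB.instance Definition _ := GRing.Zmodule.on (rep_end M).

Definition rep_end_one : rep_end M.
Proof. by refine (@RepHom _ _ M M (fun x v => v) _ _). Defined.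

Definition rep_end_mul (a b : rep_end M) : rep_end M.
Proof.
refine (@RepHom _ _ M M (fun x v => a x (b x v)) _ _).
- by move=> x c u v; rewrite !rep_hom_linear.
- by move=> x y g v; rewrite !rep_hom_natural.
Defined.

Lemma rep_end_mulA : associative rep_end_mul.
Proof. by move=> a b c; apply: rep_homP. Qed.

Lemma rep_end_mul1 : left_id rep_end_one rep_end_mul.
Proof. by move=> a; apply: rep_homP. Qed.

Lemma rep_end_mulr1 : right_id rep_end_one rep_end_mul.
Proof. by move=> a; apply: rep_homP. Qed.

Lemma rep_end_mulDl : left_distributive rep_end_mul +%R.
Proof. by move=> a b c; apply: rep_homP. Qed.

Lemma rep_end_mulDr : right_distributive rep_end_mul +%R.
Proof.
move=> a b c; apply: rep_homP => x v /=.
by have := rep_hom_linear a 1 (b x v) (c x v); rewrite !scale1r.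
Qed.

HB.instance Definition _ := GRing.Zmodule_isPzRing.Build (rep_end M)
  rep_end_mulA rep_end_mul1 rep_end_mulr1 rep_end_mulDl rep_end_mulDr.
End RepEnd.

Section Linearization.
Variables (k : comPzRingType) (G : groupoid) (X : gset G).

(* A function [v] on [X x] is the formal sum of the [v p] p. *)
Definition free_mod (x : G) : lmodType k := {ffun X x -> k^o}.

(* The linear extension of p |-> g p. *)
Definition free_act (x y : G) (g : hom x y) (v : free_mod x) : free_mod y :=
  [ffun q => \sum_(p | gset_act X g p == q) v p].

Lemma free_mod_fg x : finitely_generated (free_mod x).
Proof.
exists #|X x|, (fun i => [ffun p => (p == enum_val i)%:R]) => v.
exists (fun i => v (enum_val i)).
apply/ffunP => p; rewrite sum_ffunE (bigD1 (enum_rank p)) //= !ffunE.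
rewrite enum_rankK eqxx [_ *: _]mulr1 big1 ?addr0 // => i ip.
rewrite !ffunE; case: eqP => [pE|_]; last exact: mulr0.
by case/eqP: ip; rewrite pE enum_valK.
Qed.

Lemma free_act_linear x y (g : hom x y) : linear (free_act g).
Proof.
move=> a u v; apply/ffunP => q; rewrite !ffunE.
by rewrite scaler_sumr -big_split /=; apply: eq_bigr => p _; rewrite !ffunE.
Qed.

Lemma free_act_id x v : free_act (gid x) v = v.
Proof.
apply/ffunP => q; rewrite ffunE (bigD1 q) ?gset_act_id //= big1 ?addr0 //.
by move=> p; rewrite gset_act_id andbN.
Qed.

Lemma free_act_comp x y z (g : hom y z) (f : hom x y) v :
  free_act (g \c f) v = free_act g (free_act f v).
Proof.
apply/ffunP => q; rewrite !ffunE.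
under [RHS]eq_bigr => r _ do rewrite ffunE.
rewrite (partition_big (gset_act X f) (fun r => gset_act X g r == q)) /=.
  apply: eq_bigr => r /eqP rq; apply: eq_bigl => p.
  rewrite gset_act_comp andbC; case: eqP => //= ->.
  by rewrite rq eqxx.
by move=> p; rewrite gset_act_comp.
Qed.

Definition free_rep : rep k G :=
  Rep free_mod_fg free_act_linear free_act_id free_act_comp.
End Linearization.

Definition yoshida_algebra (k : comPzRingType) (G : groupoid)
  (t : trivialization G) : pzRingType :=
  rep_end (free_rep k (gset_prod (omega t) (omega t))).

Section GroupoidAlgebra.
Variables (k : comPzRingType) (G : groupoid).

Definition mor : finType := {p : G * G & @hom G p.1 p.2}.

Definition Mor (x y : G) (g : hom x y) : mor :=
  existT (fun p : G * G => @hom G p.1 p.2 : Type) (x, y) g.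

Definition galg : Type := {ffun mor -> k}.

HB.instance Definition _ := GRing.Zmodule.on galg.

Definition galg_one : galg := [ffun m => [exists x, m == Mor (gid x)]%:R].

(* The coefficient at [m] of the sum of the (a_g b_f) (g f) over all
   composable pairs (g, f). *)
Definition galg_mul (a b : galg) : galg :=
  [ffun m : mor => \sum_(y : G) \sum_(f : hom (tag m).1 y)
     \sum_(g : hom y (tag m).2 | g \c f == tagged m) a (Mor g) * b (Mor f)].

Lemma galg_one_neq x y (g : hom x y) : x != y -> galg_one (Mor g) = 0.
Proof.
move=> xy; rewrite ffunE; case: existsP => // -[z /eqP/(congr1 tag)] /= [ex ey].
by rewrite ex ey eqxx in xy.
Qed.

Lemma galg_one_eq x (g : hom x x) : galg_one (Mor g) = (g == gid x)%:R.
Proof.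
rewrite ffunE; congr (nat_of_bool _)%:R; apply/existsP/eqP => [[z /eqP e]|->].
  have [ez _] := congr1 tag e; subst z.
  by move/eqP: e; rewrite eq_Tagged => /eqP.
by exists x.
Qed.

Lemma galg_mulA : associative galg_mul.
Proof.
move=> a b c; apply/ffunP => -[[x w] /= m].
pose S := \sum_(y : G) \sum_(f : hom x y) \sum_(z : G) \sum_(g : hom y z)
  \sum_(j : hom z w | j \c g \c f == m) a (Mor j) * b (Mor g) * c (Mor f).
transitivity S; rewrite /S ffunE /=.
  under eq_bigr => z _ do under eq_bigr => e _ do under eq_bigr => j _ do
    rewrite ffunE /= mulr_sumr.
  under eq_bigr => z _ do under eq_bigr => e _ do rewrite exchange_big /=.
  under eq_bigr => z _ do rewrite exchange_big /=.
  rewrite exchange_big /=; apply: eq_bigr => y _.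
  under eq_bigr => z _ do under eq_bigr => e _ do under eq_bigr => j _ do
    rewrite mulr_sumr.
  under eq_bigr => z _ do under eq_bigr => e _ do rewrite exchange_big /=.
  under eq_bigr => z _ do rewrite exchange_big /=.
  rewrite exchange_big /=; apply: eq_bigr => f _; apply: eq_bigr => z _.
  under eq_bigr => e _ do under eq_bigr => j _ do rewrite mulr_sumr.
  under eq_bigr => e _ do rewrite (exchange_big_dep xpredT) //=.
  rewrite exchange_big /=; apply: eq_bigr => g _.
  rewrite (bigD1 (g \c f)) //= [X in _ + X]big1 ?addr0.
    apply: eq_big => [j|j _]; last by rewrite mulrA.
    by rewrite eqxx andbT gcompA.
  move=> e ne; rewrite big_pred0 // => j.
  by rewrite [_ == e]eq_sym (negbTE ne) andbF.
apply: eq_bigr => y _; apply: eq_bigr => f _.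
under [RHS]eq_bigr => h _ do rewrite ffunE mulr_suml /=.
rewrite [RHS]exchange_big /=; apply: eq_bigr => z _.
under [RHS]eq_bigr => h _ do rewrite mulr_suml.
rewrite [RHS]exchange_big /=; apply: eq_bigr => g _.
under [RHS]eq_bigr => h _ do rewrite mulr_suml.
rewrite (partition_big (fun j : hom z w => j \c g) (fun h => h \c f == m)) //=.
apply: eq_bigr => h /eqP hm; apply: eq_bigl => j.
by case: (j \c g =P h) => [->|_]; rewrite ?andbF // hm eqxx.
Qed.

Lemma galg_mul1 : left_id galg_one galg_mul.
Proof.
move=> b; apply/ffunP => -[[x z] /= m]; rewrite ffunE /= (bigD1 z) //=.
rewrite [X in _ + X]big1 ?addr0 => [|y yz]; last first.
  by rewrite big1 // => f _; rewrite big1 // => g _; rewrite galg_one_neq ?mul0r.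
rewrite (bigD1 m) //= [X in _ + X]big1 ?addr0 => [|f fm].
  rewrite (bigD1 (gid z)) ?gcomp1f //= galg_one_eq eqxx mul1r big1 ?addr0 //.
  by move=> g /andP[_ /negbTE gz]; rewrite galg_one_eq gz mul0r.
rewrite big1 // => g /eqP gf; rewrite galg_one_eq; case: eqP => [g1|].
  by case/eqP: fm; rewrite -gf g1 gcomp1f.
by rewrite mul0r.
Qed.

Lemma galg_mulr1 : right_id galg_one galg_mul.
Proof.
move=> b; apply/ffunP => -[[x z] /= m]; rewrite ffunE /= (bigD1 x) //=.
rewrite [X in _ + X]big1 ?addr0 => [|y yx]; last first.
  rewrite big1 // => f _; rewrite big1 // => g _.
  by rewrite galg_one_neq ?mulr0 1?eq_sym.
rewrite (bigD1 (gid x)) //= [X in _ + X]big1 ?addr0 => [|f /negbTE fx].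
  rewrite (big_pred1 m) => [|g]; last by rewrite gcompf1.
  by rewrite galg_one_eq eqxx mulr1.
by rewrite big1 // => g _; rewrite galg_one_eq fx mulr0.
Qed.

Lemma galg_mulDl : left_distributive galg_mul +%R.
Proof.
move=> a b c; apply/ffunP => m; rewrite !ffunE -big_split /=.
apply: eq_bigr => y _; rewrite -big_split /=; apply: eq_bigr => f _.
by rewrite -big_split /=; apply: eq_bigr => g _; rewrite ffunE mulrDl.
Qed.

Lemma galg_mulDr : right_distributive galg_mul +%R.
Proof.
move=> a b c; apply/ffunP => m; rewrite !ffunE -big_split /=.
apply: eq_bigr => y _; rewrite -big_split /=; apply: eq_bigr => f _.
by rewrite -big_split /=; apply: eq_bigr => g _; rewrite ffunE mulrDr.
Qed.

HB.instance Definition _ := GRing.Zmodule_isPzRing.Build galg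
  galg_mulA galg_mul1 galg_mulr1 galg_mulDl galg_mulDr.

Definition groupoid_algebra : pzRingType := galg.

Definition galg_basis (x y : G) (g : hom x y) : groupoid_algebra :=
  [ffun m : mor => (m == Mor g)%:R] : galg.

Lemma Mor_inj x y : injective (@Mor x y).
Proof. by move=> f g /eqP; rewrite eq_Tagged => /eqP. Qed.

Lemma Mor_comp x y z x' y' z' (g : hom y z) (f : hom x y)
    (g' : hom y' z') (f' : hom x' y') :
  Mor g = Mor g' -> Mor f = Mor f' -> Mor (g \c f) = Mor (g' \c f').
Proof.
move=> eg ef; have [ey ez] := congr1 tag eg; have [ex _] := congr1 tag ef.
by subst y' z' x'; rewrite (Mor_inj eg) (Mor_inj ef).
Qed.

Lemma galg_basis_comp x y z (g : hom y z) (f : hom x y) :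
  galg_basis g * galg_basis f = galg_basis (g \c f).
Proof.
apply/ffunP => m; rewrite [RHS]ffunE.
case: eqP => [->|mgf]; rewrite ffunE /=.
  rewrite (bigD1 y) //= (bigD1 f) //= (bigD1 g) //= !ffunE !eqxx mulr1.
  rewrite !big1 ?addr0 // => [w wy|h hf|h /andP[_ hg]].
  - rewrite big1 // => h _; rewrite big1 // => j _; rewrite !ffunE.
    case: eqP => [|_]; last by rewrite mul0r.
    by case/(congr1 tag) => wE; rewrite wE eqxx in wy.
  - rewrite big1 // => j _; rewrite !ffunE.
    case: (Mor h =P _) => [/Mor_inj hE|_]; last by rewrite mulr0.
    by rewrite hE eqxx in hf.
  - rewrite !ffunE; case: eqP => [/Mor_inj hE|_]; last by rewrite mul0r.
    by rewrite hE eqxx in hg.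
case: m mgf => [[u w] m] /= mgf.
rewrite big1 // => v _; rewrite big1 // => h _; rewrite big1 // => j /eqP jh.
rewrite !ffunE; case: eqP => [jg|_]; last by rewrite mul0r.
case: eqP => [hf|_]; last by rewrite mulr0.
by case: mgf; rewrite -(Mor_comp jg hf) jh.
Qed.

Lemma galg_basis_neq x y x' y' (g : hom x y) (f : hom x' y') :
  x != y' -> galg_basis g * galg_basis f = 0.
Proof.
move=> xy; apply/ffunP => m; rewrite !ffunE.
rewrite big1 // => v _; rewrite big1 // => h _; rewrite big1 // => j _.
rewrite !ffunE; case: eqP => [jg|_]; last by rewrite mul0r.
case: eqP => [hf|_]; last by rewrite mulr0.
have [vx _] := congr1 tag jg; have [_ vy] := congr1 tag hf.
by rewrite -vx vy eqxx in xy.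
Qed.
End GroupoidAlgebra.

Lemma trivialization_inhabited (G : groupoid) : inhabited (trivialization G).
Proof.
have base (C : component G) : {b : component_obj C | True}.
  have : exists b : component_obj C, true.
    case: C => C Cp; have /imsetP[z _ Cz] := Cp.
    have zC : z \in C by rewrite Cz !inE gconnxx.
    by exists (exist _ z zC).
  by case/sigW => b _; exists b.
pose b C := sval (base C).
have path (C : component G) (x : component_obj C) :
    {m : @hom (component_groupoid C) (b C) x | True}.
  have : gconn (val (b C)) (val x).
    by rewrite -in_component_of -(component_ofP (valP (b C))); exact: (valP x).
  by case/card_gt0P/cid => m _; exists m.
pose m C x := sval (path C x).
constructor; unshelve refine (@Trivialization G b
  (fun C x y a => m C y \c (a.1 : hom (val (b C)) (val (b C)))
     \c ginv (m C x)) _ _ _).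
- by move=> C x /=; rewrite gcompf1 gcompfV.
- move=> C x y z [g []] [f []] /=.
  by rewrite /mulg /= !gcompA ginvK.
- move=> C x y; exists (fun f => (ginv (m C y) \c f \c m C x, tt)).
    move=> [a []] /=; congr pair.
    by rewrite !gcompA gcompVf gcomp1f ginvK.
  move=> f /=; rewrite !gcompA gcompfV gcomp1f -gcompA gcompfV.
  exact: gcompf1.
Qed.

(* Main.v *)
(** A central element of [k[G]] is supported on the isotropy groups and invariant
    under conjugation, so it acts naturally on every representation [M] of [G];
    this gives a ring map from the center of [k[G]] to that of [End M].  Suppose
    that [M = k[X]] and that at every object [x] there is a point [e x] of [X x]
    such that [g |-> g (e x)] is injective on each [hom x y].  Then for every [v]
    in [M x] there is an endomorphism of [M] sending [e x] to [v], so a central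
    [phi] satisfies [phi v = \sum_g phi (e x) (g (e x)) g v]: it is the action of
    the element of [k[G]] whose coefficient at [g : x -> x] is
    [phi (e x) (g (e x))], and this element is central by naturality of [phi].
    For [X = Omega^2] one takes [e x = (<1, 1>, <1, 1>)]. *)
From Pilot Require Import Defs.
From HB Require Import structures.
From mathcomp Require Import all_boot all_order all_fingroup all_algebra.
From mathcomp Require Import boolp.

Set Implicit Arguments.
Unset Strict Implicit.
Unset Printing Implicit Defensive.

(* [all_algebra] shadows [hom]. *)
Import Pilot.Defs.
Import GRing.Theory.
Local Open Scope ring_scope.
Local Open Scope groupoid_scope.

(** * Cancellation and conjugation in a groupoid *)

Section GroupoidTheory.
Context {G : groupoid}.

Lemma gcompKV {x y z : G} (h : hom z y) (f : hom x y) : h \c (ginv h \c f) = f.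
Proof. by rewrite gcompA gcompfV gcomp1f. Qed.

Lemma gcompVK {x y z : G} (h : hom y z) (f : hom x y) : ginv h \c (h \c f) = f.
Proof. by rewrite gcompA gcompVf gcomp1f. Qed.

Lemma gcompfVK {x y z : G} (f : hom y z) (h : hom x y) :
  f \c h \c ginv h = f.
Proof. by rewrite -gcompA gcompfV gcompf1. Qed.

Lemma eq_gcompl {x y z : G} (g : hom y z) (f : hom x y) (m : hom x z) :
  (g \c f == m) = (f == ginv g \c m).
Proof. by apply/eqP/eqP => [<-|->]; rewrite ?gcompVK ?gcompKV. Qed.

Lemma eq_gcompr {x y z : G} (g : hom y z) (f : hom x y) (m : hom x z) :
  (g \c f == m) = (g == m \c ginv f).
Proof. by apply/eqP/eqP => [<-|->]; rewrite ?gcompfVK ?ginvK. Qed.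

Lemma conj_bij {x y : G} (h : hom x y) :
  bijective (fun g : hom x x => h \c g \c ginv h).
Proof.
exists (fun g => ginv h \c g \c h) => g.
  by rewrite -gcompA ginvK gcompVK.
by rewrite -gcompA gcompfVK gcompKV.
Qed.

Lemma gset_actK (X : gset G) {x y : G} (g : hom x y) (p : X x) :
  gset_act X (ginv g) (gset_act X g p) = p.
Proof. by rewrite -gset_act_comp gcompVf gset_act_id. Qed.

Lemma gset_actVK (X : gset G) {x y : G} (g : hom x y) (q : X y) :
  gset_act X g (gset_act X (ginv g) q) = q.
Proof. by rewrite -gset_act_comp gcompfV gset_act_id. Qed.
End GroupoidTheory.

(** * The center of the groupoid algebra, described by coefficients *)

Section AlgebraCenter.
Context {k : comPzRingType} {G : groupoid}.
Implicit Types a b : galg k G.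

Definition isotropy_supported a :=
  forall (x y : G) (g : hom x y), x != y -> a (Mor g) = 0.

(** Substituting [f = h \c g] gives the usual $a(hgh^{-1}) = a(g)$; the form with two parallel
    morphisms is the one read off from commutation with the basis element of [h]. *)
Definition conj_invariant a :=
  forall (x y : G) (f h : hom x y), a (Mor (f \c ginv h)) = a (Mor (ginv h \c f)).

(** In a factorization $m = gf$ only loops [g] at [y] contribute, and then [f] determines $g =
    mf^{-1}$. *)
Lemma galg_mul_supportedl a b {x y : G} (m : hom x y) : isotropy_supported a ->
  galg_mul a b (Mor m) = \sum_(f : hom x y) a (Mor (m \c ginv f)) * b (Mor f).
Proof.
move=> a0; rewrite ffunE /= (bigD1 y) //= [X in _ + X]big1 ?addr0.
  apply: eq_bigr => f _; rewrite (big_pred1 (m \c ginv f)) // => g.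
  by rewrite eq_gcompr.
move=> z zy; rewrite big1 // => f _; rewrite big1 // => g _.
by rewrite a0 ?mul0r.
Qed.

Lemma galg_mul_supportedr a b {x y : G} (m : hom x y) : isotropy_supported b ->
  galg_mul a b (Mor m) = \sum_(g : hom x y) a (Mor g) * b (Mor (ginv g \c m)).
Proof.
move=> b0; rewrite ffunE /= (bigD1 x) //= [X in _ + X]big1 ?addr0.
  rewrite (exchange_big_dep xpredT) //=.
  apply: eq_bigr => g _; rewrite (big_pred1 (ginv g \c m)) // => f.
  by rewrite eq_gcompl.
move=> z zx; rewrite big1 // => f _; rewrite big1 // => g _.
by rewrite b0 ?mulr0 // eq_sym.
Qed.

Lemma galg_mul_basisr a {x y z : G} (h : hom x y) (f : hom x z) :
  galg_mul a (galg_basis k h) (Mor f) = a (Mor (f \c ginv h)).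
Proof.
rewrite ffunE /= (bigD1 y) //= [X in _ + X]big1 ?addr0; last first.
  move=> w wy; rewrite big1 // => j _; rewrite big1 // => g _; rewrite ffunE.
  case: eqP => [/(congr1 tag)[e]|_]; last by rewrite mulr0.
  by rewrite e eqxx in wy.
rewrite (bigD1 h) //= [X in _ + X]big1 ?addr0; last first.
  move=> j jh; rewrite big1 // => g _; rewrite ffunE.
  case: eqP => [/Mor_inj e|_]; last by rewrite mulr0.
  by rewrite e eqxx in jh.
rewrite (big_pred1 (f \c ginv h)) => [|g]; last by rewrite eq_gcompr.
by rewrite ffunE eqxx mulr1.
Qed.

Lemma galg_mul_basisl a {x y z : G} (h : hom y z) (f : hom x z) :
  galg_mul (galg_basis k h) a (Mor f) = a (Mor (ginv h \c f)).
Proof.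
rewrite ffunE /= (bigD1 y) //= [X in _ + X]big1 ?addr0; last first.
  move=> w wy; rewrite big1 // => j _; rewrite big1 // => g _; rewrite ffunE.
  case: eqP => [/(congr1 tag)[e]|_]; last by rewrite mul0r.
  by rewrite e eqxx in wy.
rewrite (exchange_big_dep xpredT) //= (bigD1 h) //= [X in _ + X]big1 ?addr0.
  rewrite (big_pred1 (ginv h \c f)) => [|g]; last by rewrite eq_gcompl.
  by rewrite ffunE eqxx mul1r.
move=> j jh; rewrite big1 // => g _; rewrite ffunE.
case: eqP => [/Mor_inj e|_]; last by rewrite mul0r.
by rewrite e eqxx in jh.
Qed.

Lemma galg_mul_basisl_neq a {x y z w : G} (h : hom y z) (f : hom x w) :
  z != w -> galg_mul (galg_basis k h) a (Mor f) = 0.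
Proof.
move=> zw; rewrite ffunE big1 // => v _; rewrite big1 // => j _.
rewrite big1 // => g _; rewrite ffunE.
case: eqP => [/(congr1 tag)[_ e]|_]; last by rewrite mul0r.
by rewrite e eqxx in zw.
Qed.

(** Commuting with identities kills the coefficients off the isotropy groups, and commuting with a
    basis morphism gives invariance. Conversely, the two convolution formulas for $ab$ and $ba$ at
    [m] agree term by term. *)
Lemma galg_centerP (a : groupoid_algebra k G) :
  a \in @in_center (groupoid_algebra k G) <->
  isotropy_supported a /\ conj_invariant a.
Proof.
split=> [/in_centerP ca|[a0 ac]].
  split=> [x y g xy|x y f h].
    have := congr1 (fun c : galg k G => c (Mor g)) (ca (galg_basis k (gid x))).
    rewrite [LHS]galg_mul_basisr [X in _ = X]galg_mul_basisl_neq //.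
    by rewrite ginv_id gcompf1.
  have := congr1 (fun c : galg k G => c (Mor f)) (ca (galg_basis k h)).
  by rewrite [LHS]galg_mul_basisr [X in _ = X]galg_mul_basisl.
apply/in_centerP => b; apply/ffunP => -[[x y] m].
rewrite [LHS](galg_mul_supportedl _ m) // [RHS](galg_mul_supportedr _ m) //.
by apply: eq_bigr => f _; rewrite ac mulrC.
Qed.
End AlgebraCenter.

(** * The ring map from the center of $k[G]$ to the center of $\mathrm{End}(M)$ *)

Section CentralAction.
Context {k : comPzRingType} {G : groupoid}.
Variable M : rep k G.
Implicit Types a b : galg k G.

Definition isotropy_act a (x : G) (v : M x) : M x :=
  \sum_(g : hom x x) a (Mor g) *: rep_act M g v.

Lemma rep_actZ {x y : G} (g : hom x y) c (v : M x) :
  rep_act M g (c *: v) = c *: rep_act M g v.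
Proof. by have := rep_act_linear g c v 0; rewrite !addr0 rep_act0 addr0. Qed.

Lemma rep_act_sum {x y : G} (g : hom x y) (I : finType) (F : I -> M x) :
  rep_act M g (\sum_i F i) = \sum_i rep_act M g (F i).
Proof. exact: (big_morph _ (rep_actD g) (rep_act0 M g)). Qed.

Lemma isotropy_act_linear a x : linear (@isotropy_act a x).
Proof.
move=> c u v; rewrite /isotropy_act scaler_sumr -big_split /=.
apply: eq_bigr => g _.
by rewrite rep_act_linear scalerDr !scalerA [_ * c]mulrC.
Qed.

(** Conjugation by [h] matches loops at [x] with loops at [y], and $(hgh^{-1})h = hg$. *)
Lemma isotropy_act_natural a : conj_invariant a ->
  forall (x y : G) (h : hom x y) (v : M x),
  isotropy_act a (rep_act M h v) = rep_act M h (isotropy_act a v).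
Proof.
move=> ac x y h v; rewrite /isotropy_act rep_act_sum.
rewrite (reindex (fun g : hom x x => h \c g \c ginv h)) /=; last first.
  exact/onW_bij/conj_bij.
by apply: eq_bigr => g _; rewrite rep_actZ -!rep_act_comp ac gcompVK ginvK.
Qed.

Lemma center_supported (z : center (groupoid_algebra k G)) :
  isotropy_supported (val z : galg k G).
Proof. by have /galg_centerP[] := valP z. Qed.

Lemma center_conj (z : center (groupoid_algebra k G)) :
  conj_invariant (val z : galg k G).
Proof. by have /galg_centerP[] := valP z. Qed.

Definition center_act_end (z : center (groupoid_algebra k G)) : rep_end M :=
  RepHom (isotropy_act_linear (val z)) (isotropy_act_natural (center_conj z)).

(** An endomorphism is linear and, by naturality, commutes with the action of each loop, hence with
    their linear combinations. *)
Lemma center_act_central z : center_act_end z \in @in_center (rep_end M).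
Proof.
apply/in_centerP => b; apply: rep_homP => x v /=; rewrite /isotropy_act.
have bD : {morph b x : u w / u + w}.
  by move=> u w; have := rep_hom_linear b 1 u w; rewrite !scale1r.
have b0 : b x 0 = 0 by apply: (addIr (b x 0)); rewrite -bD !add0r.
rewrite (big_morph _ bD b0); apply: eq_bigr => g _.
rewrite -rep_hom_natural.
by have := rep_hom_linear b (val z (Mor g)) (rep_act M g v) 0;
  rewrite b0 !addr0 => ->.
Qed.

Definition center_act (z : center (groupoid_algebra k G)) : center (rep_end M) :=
  Center (center_act_central z).

Lemma center_act_zmod : zmod_morphism center_act.
Proof.
move=> z w; apply: val_inj; rewrite rmorphB; apply: rep_homP => x v /=.
rewrite /isotropy_act -sumrN -big_split /=; apply: eq_bigr => g _.
by rewrite !ffunE scalerBl.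
Qed.

Lemma center_act_monoid : monoid_morphism center_act.
Proof.
split=> [|z w]; apply: val_inj; rewrite ?rmorph1 ?rmorphM;
    apply: rep_homP => x v /=; rewrite /isotropy_act.
  rewrite (bigD1 (gid x)) //= galg_one_eq eqxx scale1r rep_act_id.
  by rewrite big1 ?addr0 // => g /negbTE gx; rewrite galg_one_eq gx scale0r.
under eq_bigr => g _ do
  rewrite (galg_mul_supportedl _ _ (center_supported z)) scaler_suml.
under [RHS]eq_bigr => g _ do rewrite rep_act_sum scaler_sumr.
rewrite exchange_big [RHS]exchange_big /=; apply: eq_bigr => f _.
(* For fixed [f], replacing [g] by $gf$ turns the coefficient $z(gf^{-1})w(f)$ into $z(g)w(f)$,
   matching the composite of the two actions. *)
rewrite (reindex (fun g : hom x x => g \c f)) /=; last first.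
  by exists (fun g => g \c ginv f) => g _; rewrite ?gcompfVK ?ginvK.
by apply: eq_bigr => g _; rewrite gcompfVK rep_act_comp rep_actZ scalerA.
Qed.

HB.instance Definition _ := GRing.isZmodMorphism.Build
  (center (groupoid_algebra k G)) (center (rep_end M)) center_act
  center_act_zmod.
HB.instance Definition _ := GRing.isMonoidMorphism.Build
  (center (groupoid_algebra k G)) (center (rep_end M)) center_act
  center_act_monoid.
End CentralAction.

(** * Central endomorphisms of $k[X]$ when every object has a free point *)

Section FreePoint.
Context {k : comPzRingType} {G : groupoid} {X : gset G}.
Variable e : forall x : G, X x.
Hypothesis e_free : forall x y : G,
  injective (fun g : hom x y => gset_act X g (e x)).

Local Notation M := (free_rep k X).

Definition delta {x : G} (p : X x) : M x := [ffun q => (q == p)%:R].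

Lemma free_actE {x y : G} (g : hom x y) (v : free_mod k X x) q :
  free_act g v q = v (gset_act X (ginv g) q).
Proof.
rewrite ffunE (big_pred1 (gset_act X (ginv g) q)) // => p /=.
by apply/eqP/eqP => [<-|->]; rewrite ?gset_actK ?gset_actVK.
Qed.

Lemma free_act_delta {x y : G} (g : hom x y) (p : X x) :
  rep_act M g (delta p) = delta (gset_act X g p).
Proof.
apply/ffunP => q; rewrite [LHS]free_actE !ffunE; congr (nat_of_bool _)%:R.
by apply/eqP/eqP => [<-|->]; rewrite ?gset_actK ?gset_actVK.
Qed.

(** By freeness the points $h(e_x)$ are pairwise distinct, so coefficients can be read off. *)
Lemma sum_delta_free {x y : G} (c : hom x y -> k) (g : hom x y) :
  (\sum_h c h *: (delta (gset_act X h (e x)) : free_mod k X y))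
    (gset_act X g (e x)) = c g.
Proof.
rewrite sum_ffunE (bigD1 g) //= [X in _ + X]big1 ?addr0 => [|h hg].
  by rewrite !ffunE eqxx [LHS]mulr1.
rewrite !ffunE; case: eqP => [/e_free gh|_]; last exact: mulr0.
by rewrite gh eqxx in hg.
Qed.

Section Extension.
Variables (x : G) (v : free_mod k X x).

(** The orbit of $e_x$ is a copy of the representable functor $G(x,-)$; this is the Yoneda map
    sending $g(e_x)$ to $gv$, extended by zero to the points outside the orbit. *)
Definition ext_fun (y : G) (w : free_mod k X y) : free_mod k X y :=
  \sum_(g : hom x y) w (gset_act X g (e x)) *: free_act g v.

Lemma ext_fun_linear y : linear (@ext_fun y).
Proof.
move=> c u w; rewrite /ext_fun scaler_sumr -big_split /=.
by apply: eq_bigr => g _; rewrite !ffunE scalerDl scalerA.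
Qed.

Lemma ext_fun_natural (y z : G) (h : hom y z) (w : M y) :
  ext_fun (rep_act M h w) = rep_act M h (ext_fun w).
Proof.
rewrite /ext_fun rep_act_sum (reindex (fun g : hom x y => h \c g)) /=; last first.
  by exists (fun g => ginv h \c g) => g _; rewrite ?gcompKV ?gcompVK.
apply: eq_bigr => g _.
by rewrite free_actE -gset_act_comp gcompVK free_act_comp [RHS](@rep_actZ _ _ M).
Qed.

Definition ext_end : rep_end M :=
  @RepHom k G M M ext_fun ext_fun_linear ext_fun_natural.

Lemma ext_end_point : ext_end x (delta (e x)) = v.
Proof.
rewrite /= /ext_fun (bigD1 (gid x)) //= [X in _ + X]big1 ?addr0 => [|g gx].
  by rewrite free_act_id ffunE gset_act_id eqxx scale1r.
(* Writing $e_x$ as $\mathrm{id}_x(e_x)$ lets freeness exclude every other loop. *)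
rewrite ffunE -[X in _ == X]gset_act_id (inj_eq (@e_free x x)).
by rewrite (negbTE gx) scale0r.
Qed.
End Extension.

Definition point_coef (phi : rep_end M) {x : G} (g : hom x x) : k :=
  (phi x (delta (e x)) : free_mod k X x) (gset_act X g (e x)).

Lemma central_endE (phi : rep_end M) : phi \in @in_center (rep_end M) ->
  forall (x : G) (v : M x),
  phi x v = \sum_(g : hom x x) point_coef phi g *: rep_act M g v.
Proof.
(* Since [v] is the image of $e_x$ under [ext_end v], centrality gives $\phi(v)$ as the image of
   $\phi(e_x)$ under [ext_end v], whose definition is the desired sum. *)
move/in_centerP => cphi x v; rewrite -{1}(ext_end_point v).
exact: (congr1 (fun f : rep_end M => f x (delta (e x))) (cphi (ext_end v))).
Qed.

(** Both sides are the coefficient at $f(e_x)$ in $\phi(h e_x) = h\phi(e_x)$. The points $e_x$ and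
    $e_y$ need not be related by [h]: [central_endE] expands $\phi(h e_x)$ with the coefficients
    taken at $e_y$. *)
Lemma point_coef_conj (phi : rep_end M) : phi \in @in_center (rep_end M) ->
  forall (x y : G) (f h : hom x y),
  point_coef phi (f \c ginv h) = point_coef phi (ginv h \c f).
Proof.
move=> cphi x y f h.
have := rep_hom_natural phi h (delta (e x)).
rewrite !(central_endE cphi) rep_act_sum.
rewrite (reindex (fun g : hom x y => g \c ginv h)); last first.
  by exists (fun g => g \c h) => g _; rewrite ?gcompfVK ?ginvK.
rewrite [RHS](reindex (fun g : hom x y => ginv h \c g)); last first.
  by exists (fun g => h \c g) => g _; rewrite ?gcompKV ?gcompVK.
under eq_bigr => g _ do rewrite -rep_act_comp ginvK free_act_delta.
under [RHS]eq_bigr => g _ do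
  rewrite rep_actZ -rep_act_comp gcompKV free_act_delta.
move/(congr1 (fun v : free_mod k X y => v (gset_act X f (e x)))).
by rewrite !sum_delta_free.
Qed.

(** Summing over all loops, at most one of which equals [m], extends [point_coef] by zero without
    transporting [m] along an equality of its endpoints. *)
Definition point_elt (phi : rep_end M) : galg k G :=
  [ffun m => \sum_(x : G) \sum_(g : hom x x | Mor g == m) point_coef phi g].

Lemma point_elt_isotropy (phi : rep_end M) {x : G} (g : hom x x) :
  point_elt phi (Mor g) = point_coef phi g.
Proof.
rewrite ffunE (bigD1 x) //= [X in _ + X]big1 ?addr0 => [|y yx].
  by rewrite (big_pred1 g) // => h; rewrite /= (inj_eq (@Mor_inj G x x)).
rewrite big_pred0 // => h; apply/eqP => /(congr1 tag)[e1].
by rewrite e1 eqxx in yx.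
Qed.

Lemma point_elt_supported (phi : rep_end M) : isotropy_supported (point_elt phi).
Proof.
move=> x y g xy; rewrite ffunE big1 // => z _; rewrite big_pred0 // => h.
by apply/eqP => /(congr1 tag)[ex ey]; rewrite -ex -ey eqxx in xy.
Qed.

Lemma point_elt_central (phi : rep_end M) : phi \in @in_center (rep_end M) ->
  (point_elt phi : groupoid_algebra k G) \in @in_center (groupoid_algebra k G).
Proof.
move=> cphi; apply/galg_centerP; split=> [|x y f h].
  exact: point_elt_supported.
by rewrite !point_elt_isotropy point_coef_conj.
Qed.

Definition point_center (phi : center (rep_end M)) :
  center (groupoid_algebra k G) := Center (point_elt_central (valP phi)).

Lemma center_actK : cancel (@center_act k G M) point_center.
Proof.
move=> z; apply: val_inj; apply/ffunP => -[[x y] g] /=.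
(* Off the isotropy groups both coefficients vanish. *)
have [exy|xy] := eqVneq x y; last first.
  by rewrite [LHS](point_elt_supported _ g) // [RHS](center_supported z g).
move: g; rewrite -{}exy /= => g; rewrite [LHS](point_elt_isotropy _ g).
rewrite /point_coef /= /isotropy_act.
under eq_bigr => h _ do rewrite free_act_delta.
by rewrite (sum_delta_free (fun h : hom x x => (val z : galg k G) (Mor h))).
Qed.

Lemma point_centerK : cancel point_center (@center_act k G M).
Proof.
move=> phi; apply: val_inj; apply: rep_homP => x v /=.
rewrite [RHS](central_endE (valP phi)); apply: eq_bigr => g _.
by rewrite point_elt_isotropy.
Qed.

Lemma center_act_bij : bijective (@center_act k G M).
Proof. exact: Bijective center_actK point_centerK. Qed.
End FreePoint.

(** * A free point of Omega *)

Section OmegaPoint.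
Context {G : groupoid} (t : trivialization G).

Lemma unit_point_subproof (x : G) :
  (1%g : {set isotropy x}) \in lcosets [1 isotropy x]%G [set: isotropy x].
Proof. by apply/lcosetsP; exists 1%g => //; rewrite mulg1. Qed.

Definition unit_point (x : G) : omega t x :=
  exist (fun p : {group isotropy x} * {set isotropy x} =>
           p.2 \in lcosets p.1 [set: isotropy x])
    ([1 isotropy x]%G, 1%g : {set isotropy x}) (unit_point_subproof x).

(** The coset $\{1\}$ goes to $\{g\lambda_{x,y}^{-1}\}$, which determines [g]. *)
Lemma unit_point_free (x y : G) :
  injective (fun g : hom x y => gset_act (omega t) g (unit_point x)).
Proof.
move=> g h /(congr1 (fun p : omega_car y => (val p).2)) /=.
(* The actions of [g] and [h] use [lambda] at two proofs that [x] and [y] are connected; identifying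
   these proofs makes it the same morphism. *)
rewrite (bool_irrelevance (gconn_hom g) (gconn_hom h)) /move_set !imset_set1.
move/set1_inj; rewrite !gcompf1.
by move/(congr1 (fun f => f \c lambda t (gconn_hom h))); rewrite !ginvK.
Qed.
End OmegaPoint.

(* [t] is the choice of base objects and identifications on which Omega, hence
   the Yoshida algebra, depends; the result is stated for every choice. *)
Theorem theorem4p8 (k : comPzRingType) (G : groupoid) (t : trivialization G) :
  exists f : {rmorphism center (groupoid_algebra k G) ->
                        center (yoshida_algebra k t)},
    bijective f.
Proof.
pose X := gset_prod (omega t) (omega t).
exists (@center_act k G (free_rep k X)).
apply: (@center_act_bij k G X (fun x => (unit_point t x, unit_point t x))).
(* The first coordinate alone already separates morphisms. *)
by move=> x y g h /(congr1 fst)/unit_point_free.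
Qed.
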